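(* Let $c\in\mathbb{R}\setminus\{0\}$. If $f$ is a tropical meromorphic function on $\mathbb{R}$ with $$\limsup_{r\to\infty}\frac{\log T_f(r)}{r}=0,$$ then $$m\bigl(r,\,f(x+c)\oslash f(x)\bigr)=o\left(T_f(r)\right)$$ as $r$ tends to infinity outside of a set $E$ of zero upper density measure, i.e. $\overline{\mathrm{dens}}\,E=\limsup_{r\to\infty}\frac1r\int_{E\cap[1,r]}dt=0$.
   Context: Tropical operations: $x\oplus y=\max(x,y)$, $x\odot y=x+y$, $x\oslash y=x-y$. Thus $f(x+c)\oslash f(x)$ is the function $x\mapsto f(x+c)-f(x)$. A tropical meromorphic function is a continuous piecewise linear function $f:\mathbb{R}\to\mathbb{R}$ (possibly with infinitely many pieces, the points of derivative discontinuity being locally finite). Put $\omega_f(x)=\lim_{\varepsilon\to0+}\{f'(x+\varepsilon)-f'(x-\varepsilon)\}$; $x$ is a zero (root) of multiplicity $\omega_f(x)$ if $\omega_f(x)>0$, and a pole of multiplicity $-\omega_f(x)$ if $\omega_f(x)<0$. A tropical entire function is a tropical meromorphic function without poles (equivalently, convex). Proximity function: $m(r,f)=\frac12\{f^+(r)+f^+(-r)\}$, where $f^+(x)=\max\{f(x),0\}$. Characteristic function $T_f(r)$: write $f=f_1\oslash f_0=f_1-f_0$ with $f_0,f_1$ tropical entire functions having no common zeros (this is always possible), and set $\|f(x)\|=\max\{f_0(x),f_1(x)\}$, $T_f(r)=\frac12[\|f(r)\|+\|f(-r)\|]-\|f(0)\|$. This does not depend on the choice of $f_0,f_1$. *)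

(* Defs.v *)
From HB Require Import structures.
From mathcomp Require Import all_boot all_order all_algebra.
From mathcomp Require Import all_classical all_reals all_analysis.

Set Implicit Arguments.
Unset Strict Implicit.
Unset Printing Implicit Defensive.

Import Order.TTheory GRing.Theory Num.Theory.
Import numFieldNormedType.Exports.

Local Open Scope classical_set_scope.
Local Open Scope ring_scope.

Definition trop_add (R : realType) (x y : R) : R := Num.max x y.
Definition trop_div (R : realType) (x y : R) : R := x - y.

Definition locally_finite (R : realType) (D : set R) : Prop :=
  forall a b : R, finite_set (D `&` `[a, b]).

Definition piecewise_linear (R : realType) (f : R -> R) : Prop :=
  exists2 D : set R, locally_finite D &
    forall a b : R, `]a, b[ `&` D = set0 ->
      exists s t : R, forall x : R, x \in `]a, b[ -> f x = s * x + t.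

Definition tropical_meromorphic (R : realType) (f : R -> R) : Prop :=
  continuous f /\ piecewise_linear f.

Definition omega (R : realType) (f : R -> R) (x : R) : R :=
  lim ((fun e : R => derive1 f (x + e) - derive1 f (x - e)) @ 0^'+).

Definition is_zero (R : realType) (f : R -> R) (x : R) : Prop := 0 < omega f x.
Definition is_pole (R : realType) (f : R -> R) (x : R) : Prop := omega f x < 0.

Definition tropical_entire (R : realType) (f : R -> R) : Prop :=
  tropical_meromorphic f /\ forall x : R, ~ is_pole f x.

Definition pos_part (R : realType) (x : R) : R := Num.max x 0.

Definition proximity (R : realType) (f : R -> R) (r : R) : R :=
  2^-1 * (pos_part (f r) + pos_part (f (- r))).

(* f0 is the denominator and f1 the numerator of f *)
Definition reduced_fraction (R : realType) (f f0 f1 : R -> R) : Prop :=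
  [/\ tropical_entire f0, tropical_entire f1,
      (forall x : R, ~ (is_zero f0 x /\ is_zero f1 x)) &
      forall x : R, f x = trop_div (f1 x) (f0 x)].

Definition cartan_char (R : realType) (f0 f1 : R -> R) (r : R) : R :=
  let norm x := trop_add (f0 x) (f1 x) in
  2^-1 * (norm r + norm (- r)) - norm 0.

(* Every tropical meromorphic function has a reduced fraction, and cartan_char
   is the same for all of them; so for such f the set below is a singleton and
   the default value 0 of xget is never used. *)
Definition characteristic (R : realType) (f : R -> R) : R -> R :=
  xget (fun=> 0) [set T : R -> R | exists f0 f1 : R -> R,
    reduced_fraction f f0 f1 /\ T = cartan_char f0 f1].

Definition upper_density (R : realType) (E : set R) : \bar R :=
  limf_esup (fun r : R => (r^-1)%:E *
    \int[@lebesgue_measure R]_(t in E `&` `[1%R, r]) 1)%E (pinfty_nbhs R).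

(* Main.v *)
(** Write f = f1 - f0 with f0, f1 convex and F = max(f0, f1), so that T is the
    symmetric mean of the convex function F, normalized at 0.  For d = |c| and
    any s > 0, convexity bounds |f_i(x + c) - f_i(x)| at x = r, -r by
    O(1) + (2d/s) (T(r + d + s) + O(1)): an increment over length d is at most
    d/s times the next increment over length s.  Since T grows at least
    linearly, it suffices that T(r + d + s) <= 2 T(r) outside a set of density
    zero for every s, and then to let s tend to infinity along a diagonal set.
    Each failure of this doubling inequality raises log T by log 2, so
    log T(r) = o(r) leaves room for only o(r) disjoint failures in [1, r]. *)
Require Import Defs.
From HB Require Import structures.
From mathcomp Require Import all_boot all_order all_algebra.
From mathcomp Require Import all_classical all_reals all_analysis.
From mathcomp Require Import measurable_realfun.
From mathcomp Require Import ring lra.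

Import Order.TTheory GRing.Theory Num.Theory.
Import numFieldNormedType.Exports.

Local Open Scope classical_set_scope.
Local Open Scope ring_scope.

(** * Tropical entire functions are convex *)

(** Convexity cleared of denominators: the case [a = b] is harmless and instances feed directly into
    linear arithmetic. *)
Definition chord_convex {R : realType} (g : R -> R) : Prop :=
  forall a x b, a <= x -> x <= b ->
    (b - a) * g x <= (b - x) * g a + (x - a) * g b.

(* Adding a small multiple of the strictly convex (y - a)(y - b) to the
   difference of g and its chord excludes an interior maximum. *)
Lemma locally_midpoint_convex_chord {R : realType} (g : R -> R) :
  continuous g ->
  (forall x, \forall e \near 0^'+, 2 * g x <= g (x + e) + g (x - e)) ->
  chord_convex g.
Proof.
move=> cg mid a x b ax xb; rewrite leNgt; apply/negP => lt_chord.
(* The summand 1 keeps [q] positive and makes [h x = P - eta * (q - 1)] collapse to [eta]. *)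
pose q := (x - a) * (b - x) + 1.
have q0 : 0 < q by rewrite /q ltr_wpDl// mulr_ge0// subr_ge0.
pose P := (b - a) * g x - ((b - x) * g a + (x - a) * g b).
have P0 : 0 < P by rewrite subr_gt0.
pose eta := P / q.
have eta0 : 0 < eta by rewrite divr_gt0.
pose h y := (b - a) * g y - ((b - y) * g a + (y - a) * g b)
            + eta * ((y - a) * (y - b)).
have ha : h a = 0 by rewrite /h; ring.
have hb : h b = 0 by rewrite /h; ring.
have hx : 0 < h x.
  have -> : h x = eta.
    by rewrite /h -/P /eta /q; field; rewrite gt_eqF.
  by [].
have ch : continuous h.
  move=> y; rewrite /h.
  apply: cvgD; first apply: cvgB.
  - by apply: cvgM; [exact: cvg_cst|exact: cg].
  - by apply: cvgD; (apply: cvgM; last exact: cvg_cst);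
      apply: cvgB; by [exact: cvg_cst|exact: cvg_id].
  - apply: cvgM; first exact: cvg_cst.
    by apply: cvgM; (apply: cvgB; [exact: cvg_id|exact: cvg_cst]).
have [y yab ymax] := EVT_max (le_trans ax xb) (continuous_subspaceT ch).
have hy : 0 < h y.
  by apply: (lt_le_trans hx); apply: ymax; rewrite in_itv/= ax xb.
have ay : a < y.
  move: yab; rewrite in_itv/= => /andP[+ _]; rewrite le_eqVlt => /orP[/eqP ay|//].
  by move: hy; rewrite -ay ha !ltxx.
have yb : y < b.
  move: yab; rewrite in_itv/= => /andP[_]; rewrite le_eqVlt => /orP[/eqP ay'|//].
  by move: hy; rewrite ay' hb !ltxx.
near (0 : R)^'+ => e.
have e0 : 0 < e by [].
have ea : e < y - a by near: e; apply: nbhs_right_lt; rewrite subr_gt0.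
have eb : e < b - y by near: e; apply: nbhs_right_lt; rewrite subr_gt0.
have := ymax (y + e); have := ymax (y - e); rewrite !in_itv/=.
move=> /(_ ltac:(apply/andP; split; lra)) h1 /(_ ltac:(apply/andP; split; lra)) h2.
have gm : 2 * g y <= g (y + e) + g (y - e) by near: e; exact: mid.
have ba0 : 0 < b - a by lra.
have k1 : 0 <= (b - a) * (g (y + e) + g (y - e) - 2 * g y).
  by apply: mulr_ge0; lra.
have k2 : 0 < eta * (e * e) by rewrite mulr_gt0// mulr_gt0.
(* At a maximum this second difference is at most 0, while the right-hand side is positive. *)
have k3 : h (y + e) + h (y - e) - 2 * h y =
   (b - a) * (g (y + e) + g (y - e) - 2 * g y) + 2 * (eta * (e * e)).
  by rewrite /h; ring.
lra.
Unshelve. all: by end_near.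
Qed.

(** A finite set is closed, so its complement contains a ball around [x]; the minimum with 1 stays
    inside the window where finiteness is known. *)
Lemma locally_finite_isolated {R : realType} (D : set R) (x : R) :
  locally_finite D ->
  exists2 d : R, 0 < d & forall y, D y -> y != x -> d <= `|y - x|.
Proof.
move=> /(_ (x - 1) (x + 1)) finD.
pose A := (D `&` `[x - 1, x + 1]) `\ x.
have : closed A.
  apply: (accessible_finite_set_closed.1 _ A); last first.
    by apply: sub_finite_set finD => y [].
  exact: (hausdorff_accessible (@Rhausdorff R)).
rewrite -openC => /(_ x); case.
  by move=> [_]; apply.
move=> d /= d0 dA; exists (Num.min d 1); first by rewrite lt_min d0 ltr01.
move=> y Dy yx; rewrite leNgt; apply/negP; rewrite lt_min => /andP[yd y1].
apply: (dA y); first by rewrite /ball/= distrC.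
split; last by move/eqP: yx.
split=> //=; rewrite in_itv/=; move: y1; rewrite ltr_norml => /andP[? ?].
by apply/andP; split; lra.
Qed.

(** Each side of [x] has a short interval free of break points; continuity, through uniqueness of
    one-sided limits, makes both affine formulas agree with [g x] at [x]. *)
Lemma piecewise_linear_germ {R : realType} (g : R -> R) (x : R) :
  tropical_meromorphic g ->
  exists s0 s1 : R, \forall e \near 0^'+,
    g (x - e) = g x - s0 * e /\ g (x + e) = g x + s1 * e.
Proof.
move=> [cg [D finD linD]].
have [d d0 dD] := locally_finite_isolated D x finD.
have [|s1 [t1 g1]] := linD x (x + d).
  rewrite -subset0 => y/= [] /[!in_itv]/= /andP[xy yd] Dy.
  have := dD y Dy; rewrite gt_eqF// => /(_ isT); rewrite gtr0_norm; lra.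
have [|s0 [t0 g0]] := linD (x - d) x.
  rewrite -subset0 => y/= [] /[!in_itv]/= /andP[xy yd] Dy.
  have := dD y Dy; rewrite lt_eqF// => /(_ isT); rewrite ltr0_norm; lra.
have cl (s t : R) : {for x, continuous (fun y : R => s * y + t)}.
  by apply: cvgD; [apply: cvgM; [exact: cvg_cst|exact: cvg_id]|exact: cvg_cst].
have gx1 : g x = s1 * x + t1.
  apply: (@cvg_unique _ (@Rhausdorff R) (g @ x^'+)).
    by apply: cvg_at_right_filter; exact: cg.
  apply: (cvg_trans _ (cvg_at_right_filter (cl s1 t1))).
  apply: near_eq_cvg; near=> y; apply/esym/g1.
  by rewrite in_itv/=; apply/andP; split=> //; near: y; apply: nbhs_right_lt; lra.
have gx0 : g x = s0 * x + t0.
  apply: (@cvg_unique _ (@Rhausdorff R) (g @ x^'-)).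
    by apply: cvg_at_left_filter; exact: cg.
  apply: (cvg_trans _ (cvg_at_left_filter (cl s0 t0))).
  apply: near_eq_cvg; near=> y; apply/esym/g0.
  by rewrite in_itv/=; apply/andP; split=> //; near: y; apply: nbhs_left_gt; lra.
exists s0, s1; near=> e.
have e0 : 0 < e by [].
have ed : e < d by near: e; exact: nbhs_right_lt.
split.
  by rewrite g0 ?gx0 ?in_itv/=; [ring|apply/andP; split; lra].
by rewrite g1 ?gx1 ?in_itv/=; [ring|apply/andP; split; lra].
Unshelve. all: by end_near.
Qed.

Lemma derive1_affine_on {R : realType} (g : R -> R) (a b y s t : R) :
  a < y < b -> (forall z, a < z < b -> g z = s * z + t) -> derive1 g y = s.
Proof.
move=> yab gE.
have gEy : \forall z \near y, g z = s * z + t.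
  have yI : y \in `]a, b[ by rewrite in_itv.
  by apply: filterS (near_in_itvoo yI) => z; rewrite in_itv/=; exact: gE.
rewrite derive1E (near_eq_derive _ gEy).
have H : is_derive y 1 (fun z : R => s * z + t) (s *: 1 + 0).
  apply: is_deriveD.
by rewrite derive_val addr0 /GRing.scale/= mulr1.
Qed.

Lemma omega_germ {R : realType} (g : R -> R) (x s0 s1 : R) :
  (\forall e \near 0^'+, g (x - e) = g x - s0 * e /\ g (x + e) = g x + s1 * e) ->
  omega g x = s1 - s0.
Proof.
rewrite near_withinE => -[d /= d0 germ].
have {}germ e : 0 < e -> e < d ->
    g (x - e) = g x - s0 * e /\ g (x + e) = g x + s1 * e.
  by move=> e0 ed; apply: germ => //=; rewrite sub0r normrN gtr0_norm.
apply/cvg_lim => //; apply: cvg_near_cst; near=> e.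
have e0 : 0 < e by [].
have ed : e < d by near: e; exact: nbhs_right_lt.
congr (_ - _).
  apply: (@derive1_affine_on _ _ x (x + d) _ _ (g x - s1 * x)).
    by apply/andP; split; lra.
  move=> z /andP[xz zd]; have [||_] := germ (z - x); [lra|lra|].
  by rewrite addrC subrK => ->; ring.
apply: (@derive1_affine_on _ _ (x - d) x _ _ (g x - s0 * x)).
  by apply/andP; split; lra.
move=> z /andP[zd xz]; have [||+ _] := germ (x - z); [lra|lra|].
by rewrite opprB addrC subrK => ->; ring.
Unshelve. all: by end_near.
Qed.

(** Absence of poles means [s0 <= s1], and [g (x + e) + g (x - e) - 2 * g x = (s1 - s0) * e] for
    small [e]: local midpoint convexity. *)
Lemma tropical_entire_chord_convex {R : realType} (g : R -> R) :
  tropical_entire g -> chord_convex g.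
Proof.
move=> [mg nopole]; apply: locally_midpoint_convex_chord; first by case: mg.
move=> x; have [s0 [s1 germ]] := piecewise_linear_germ g x mg.
have s01 : s0 <= s1.
  rewrite -subr_ge0 -(omega_germ g x s0 s1 germ) leNgt; apply/negP; exact: nopole.
near=> e.
have [-> ->] : g (x - e) = g x - s0 * e /\ g (x + e) = g x + s1 * e.
  by near: e.
have : 0 <= (s1 - s0) * e by apply: mulr_ge0 => //; rewrite subr_ge0.
lra.
Unshelve. all: by end_near.
Qed.


(** * Symmetric means and increments of convex functions *)

Lemma chord_convex_reflect {R : realType} (g : R -> R) :
  chord_convex g -> chord_convex (fun x => g (- x)).
Proof.
move=> cg a x b ax xb; have := cg (- b) (- x) (- a).
by rewrite !lerN2 => /(_ xb ax); lra.
Qed.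

Lemma chord_convex_max {R : realType} (f g : R -> R) :
  chord_convex f -> chord_convex g ->
  chord_convex (fun x => trop_add (f x) (g x)).
Proof.
move=> cf cg a x b ax xb; have ab := le_trans ax xb.
rewrite /trop_add maxr_pMr ?subr_ge0// ge_max.
by apply/andP; split; [apply: (le_trans (cf a x b ax xb))
  |apply: (le_trans (cg a x b ax xb))];
  apply: lerD; rewrite ler_wpM2l ?subr_ge0// le_max lexx ?orbT.
Qed.

(** The slope of the chord from the origin is nondecreasing; applied to the characteristic, this
    gives its growth at least linear. *)
Lemma star_shaped_le {R : realType} (g : R -> R) (a b : R) :
  chord_convex g -> g 0 = 0 -> 0 <= a -> a <= b -> b * g a <= a * g b.
Proof.
by move=> cg g0 a0 ab; have := cg 0 a b a0 ab; rewrite g0; lra.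
Qed.

Lemma star_shaped_nondecreasing {R : realType} (g : R -> R) (a b : R) :
  chord_convex g -> g 0 = 0 -> 0 <= g b -> 0 <= a -> a <= b -> g a <= g b.
Proof.
move=> cg g0 gb a0 ab; have [b0|b0] := leP b 0.
  by have -> : a = b by lra.
rewrite -(ler_pM2l b0); apply: (le_trans (star_shaped_le g a b cg g0 a0 ab)).
exact: ler_wpM2r.
Qed.

(** For tropical entire [g], the tropical Jensen formula identifies this with the integrated
    counting function of the roots. *)
Definition jensen_mean {R : realType} (g : R -> R) (r : R) : R :=
  2^-1 * (g r + g (- r)) - g 0.

Lemma jensen_mean0 {R : realType} (g : R -> R) : jensen_mean g 0 = 0.
Proof. by rewrite /jensen_mean oppr0; lra. Qed.

Lemma jensen_meanN {R : realType} (g : R -> R) (r : R) :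
  jensen_mean (fun x => g (- x)) r = jensen_mean g r.
Proof. by rewrite /jensen_mean opprK oppr0 (addrC (g r)). Qed.

Lemma jensen_mean_ge0 {R : realType} (g : R -> R) (r : R) :
  chord_convex g -> 0 <= r -> 0 <= jensen_mean g r.
Proof.
rewrite le_eqVlt => cg /predU1P[<-|r0]; first by rewrite jensen_mean0.
have := cg (- r) 0 r; rewrite oppr_le0 (ltW r0) => /(_ isT isT) c0.
rewrite -(pmulr_rge0 _ r0) /jensen_mean; lra.
Qed.

Lemma chord_convex_jensen_mean {R : realType} (g : R -> R) :
  chord_convex g -> chord_convex (jensen_mean g).
Proof.
move=> cg a x b ax xb; rewrite /jensen_mean.
have := cg a x b ax xb; have := chord_convex_reflect g cg a x b ax xb.
lra.
Qed.

(* After subtracting the affine function through (0, g 0) and (1, g 1), a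
   convex g vanishes at 0 and 1, so it is nonnegative outside ]0, 1[ and
   nondecreasing on [1, +oo[; hence it is at most 2 * jensen_mean g there. *)
Lemma chord_convex_increment {R : realType} (g : R -> R) (d s u v : R) :
  chord_convex g -> 1 <= u -> u <= v -> v - u <= d -> 0 < s ->
  `|g v - g u| <= d * `|g 1 - g 0| + 2 * d / s * jensen_mean g (v + s).
Proof.
move=> cg u1 uv vu s0.
pose k := g 1 - g 0; pose h x := g x - (g 0 + k * x).
have h0 : h 0 = 0 by rewrite /h; ring.
have h1 : h 1 = 0 by rewrite /h /k; ring.
have ch : chord_convex h.
  by move=> a x b ax xb; have := cg a x b ax xb; rewrite /h; lra.
have h_ge0 x : 1 <= x -> 0 <= h x.
  by move=> x1; have := ch 0 1 x ler01 x1; rewrite h0 h1; lra.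
have hN x : 0 <= x -> 0 <= h (- x).
  move=> x0; have := ch (- x) 0 1; rewrite oppr_le0 x0 ler01 => /(_ isT isT).
  by rewrite h0 h1; lra.
have huv : h u <= h v.
  have [v1|v1] := leP v 1; first by have -> : u = v by lra.
  have := ch 1 u v u1 uv; rewrite h1 => H.
  have H0 : 0 <= (v - u) * h v by apply: mulr_ge0; [lra|apply: h_ge0; lra].
  have vm1 : 0 < v - 1 by lra.
  by rewrite -(ler_pM2l vm1); lra.
(* The affine part cancels in the symmetric mean, and the reflected value of [h] is nonnegative. *)
have hw : h (v + s) <= 2 * jensen_mean g (v + s).
  have -> : 2 * jensen_mean g (v + s) = h (v + s) + h (- (v + s)).
    by rewrite /jensen_mean /h; field.
  by rewrite lerDl hN; lra.
have hv : 0 <= h v by apply: h_ge0; lra.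
have hu : 0 <= h u by apply: h_ge0.
have vs : v <= v + s by lra.
have inc : s * (h v - h u) <= (v - u) * (h (v + s) - h v).
  by have := ch u v (v + s) uv vs; lra.
have hvu : h v - h u <= 2 * d / s * jensen_mean g (v + s).
  rewrite -(ler_pM2l s0); apply: (le_trans inc).
  have -> : s * (2 * d / s * jensen_mean g (v + s)) =
      d * (2 * jensen_mean g (v + s)) by field; rewrite gt_eqF.
  apply: (@le_trans _ _ ((v - u) * (2 * jensen_mean g (v + s)))).
    by rewrite ler_wpM2l//; lra.
  by rewrite ler_wpM2r//; have := h_ge0 (v + s); lra.
have -> : g v - g u = k * (v - u) + (h v - h u) by rewrite /h; ring.
apply: (le_trans (ler_normD _ _)); apply: lerD.
  by rewrite normrM mulrC (ger0_norm (_ : 0 <= v - u)) ?ler_wpM2r//; lra.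
by rewrite ger0_norm//; lra.
Qed.

(** The condition on [r] keeps both points in [[1, +oo[]. For [c < 0] the increment ends at [r], and
    monotonicity of the mean moves the bound from [r + s] to [r + |c| + s]. *)
Lemma chord_convex_shift {R : realType} (g : R -> R) (c s r : R) :
  chord_convex g -> 0 < s -> 1 + `|c| <= r ->
  `|g (r + c) - g r| <=
    `|c| * `|g 1 - g 0| + 2 * `|c| / s * jensen_mean g (r + `|c| + s).
Proof.
move=> cg s0 rc; have [c0|c0] := leP 0 c.
  rewrite (ger0_norm c0) in rc *.
  by apply: chord_convex_increment => //; lra.
rewrite (ltr0_norm c0) in rc * => /=.
rewrite distrC.
have -> : r + - c + s = r + (s - c) by ring.
apply: (@le_trans _ _ (- c * `|g 1 - g 0| + 2 * - c / s * jensen_mean g (r + s))).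
  by apply: chord_convex_increment => //; lra.
rewrite lerD2l ler_wpM2l//; first by rewrite divr_ge0//; lra.
apply: star_shaped_nondecreasing; [exact: chord_convex_jensen_mean|exact: jensen_mean0|..].
- by apply: jensen_mean_ge0 => //; lra.
- lra.
- lra.
Qed.

Lemma chord_convex_shiftN {R : realType} (g : R -> R) (c s r : R) :
  chord_convex g -> 0 < s -> 1 + `|c| <= r ->
  `|g (- r + c) - g (- r)| <=
    `|c| * `|g (-1) - g 0| + 2 * `|c| / s * jensen_mean g (r + `|c| + s).
Proof.
move=> cg s0 rc.
have := chord_convex_shift (fun x => g (- x)) (- c) s r (chord_convex_reflect g cg) s0.
by rewrite normrN jensen_meanN oppr0 opprD opprK; apply.
Qed.

Lemma jensen_mean_le {R : realType} (g h : R -> R) (r : R) :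
  (forall x, g x <= h x) -> jensen_mean g r <= jensen_mean h r + (h 0 - g 0).
Proof. by move=> gh; rewrite /jensen_mean; have := gh r; have := gh (- r); lra. Qed.

Lemma cartan_charE {R : realType} (f0 f1 : R -> R) :
  cartan_char f0 f1 = jensen_mean (fun x => trop_add (f0 x) (f1 x)).
Proof. by []. Qed.

(** Four increments, of [f0] and [f1] at [r] and [- r], dominate the positive parts, and each mean
    is at most that of the maximum up to a constant. Since [s >= 1] gives [|c| / s <= |c|], the
    constant [K] does not depend on [s]. *)
Lemma proximity_shift_bound {R : realType} (f f0 f1 : R -> R) (c : R) :
  chord_convex f0 -> chord_convex f1 ->
  (forall x, f x = trop_div (f1 x) (f0 x)) ->
  exists K : R, forall s r : R, 1 <= s -> 1 + `|c| <= r ->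
    proximity (fun x => trop_div (f (x + c)) (f x)) r <=
      K + 4 * `|c| / s * cartan_char f0 f1 (r + `|c| + s).
Proof.
move=> cf0 cf1 fE; rewrite cartan_charE; set F := fun x => trop_add _ _.
have f0F x : f0 x <= F x by rewrite le_max lexx.
have f1F x : f1 x <= F x by rewrite le_max lexx orbT.
pose K0 := `|c| * (`|f0 1 - f0 0| + `|f0 (-1) - f0 0|) +
           `|c| * (`|f1 1 - f1 0| + `|f1 (-1) - f1 0|).
pose K1 := (F 0 - f0 0) + (F 0 - f1 0).
exists (2^-1 * K0 + 2 * `|c| * K1) => s r s1 rc.
have s0 : 0 < s by lra.
set J := jensen_mean F _.
have c0 : 0 <= `|c| by [].
have cs0 : 0 <= `|c| / s by rewrite divr_ge0// ltW.
have csc : `|c| / s <= `|c| by rewrite ler_pdivrMr// ler_peMr.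
have j0 := ler_wpM2l cs0 (jensen_mean_le f0 F (r + `|c| + s) f0F).
have j1 := ler_wpM2l cs0 (jensen_mean_le f1 F (r + `|c| + s) f1F).
have a0 := chord_convex_shift f0 c s r cf0 s0 rc.
have a1 := chord_convex_shift f1 c s r cf1 s0 rc.
have b0 := chord_convex_shiftN f0 c s r cf0 s0 rc.
have b1 := chord_convex_shiftN f1 c s r cf1 s0 rc.
have K10 : 0 <= K1 by rewrite /K1; have := f0F 0; have := f1F 0; lra.
have kc : `|c| / s * K1 <= `|c| * K1 by rewrite ler_wpM2r.
have pos (y : R) : pos_part (trop_div (f (y + c)) (f y)) <=
    `|f0 (y + c) - f0 y| + `|f1 (y + c) - f1 y|.
  rewrite /pos_part !fE /trop_div ge_max; apply/andP; split.
    have := ler_norm (f1 (y + c) - f1 y); have := lerNnormlW (lexx `|f0 (y + c) - f0 y|).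
    lra.
  by rewrite addr_ge0.
have pr := pos r; have pN := pos (- r); rewrite /proximity/=.
rewrite -/J in j0 j1; rewrite /K0; rewrite /K1 in kc *; clear K0 K1 K10 pos.
lra.
Qed.

(** * Exceptional sets of zero upper density *)

Definition doubling_set {R : realType} (T : R -> R) (x0 s : R) : set R :=
  [set r | x0 <= r /\ 2 * T r < T (r + s)].

Lemma measurable_doubling_set {R : realType} (T : R -> R) (x0 s : R) :
  continuous T -> measurable (doubling_set T x0 s).
Proof.
move=> cT.
have cTs : continuous (fun r => T (r + s)).
  move=> r; apply: (@continuous_comp _ _ _ (fun r : R => r + s) T).
    by apply: cvgD; [exact: cvg_id|exact: cvg_cst].
  exact: cT.
have c2T : continuous (fun r => 2 * T r).
  by move=> r; apply: cvgM; [exact: cvg_cst|exact: cT].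
have mlt := measurable_fun_ltr (continuous_measurable_fun c2T)
  (continuous_measurable_fun cTs).
have {}mlt : measurable ((fun r => 2 * T r < T (r + s)) @^-1` [set true]).
  by rewrite -[X in measurable X]setTI; exact: mlt.
have -> : doubling_set T x0 s =
    `[x0, +oo[ `&` (fun r => 2 * T r < T (r + s)) @^-1` [set true].
  by apply/seteqP; split=> r /=; rewrite in_itv/= andbT.
exact: measurableI.
Qed.

(* Partition [x0, +oo[ into cells of length s: a cell meeting the doubling set
   raises ln T by at least ln 2 over two consecutive cells, and these
   increments telescope. *)
Lemma doubling_set_cells {R : realType} (T : R -> R) (x0 s : R) (K : nat) :
  continuous T -> 0 < T x0 -> 0 < s ->
  (forall x y, x0 <= x -> x <= y -> T x <= T y) ->
  (lebesgue_measure (doubling_set T x0 s `&` `[x0, (x0 + K%:R * s)%R[) <=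
   (s / ln 2 * (ln (T (x0 + K.+1%:R * s)) + ln (T (x0 + K%:R * s))
                - ln (T (x0 + s)) - ln (T x0)))%:E)%E.
Proof.
move=> cT T0 s0 ndT.
have mD := measurable_doubling_set T x0 s cT.
have ln20 : 0 < ln 2 :> R by rewrite ln_gt0// ltr1n.
elim: K => [|K IH].
  rewrite mul0r mul1r addr0 set_itvco0 setI0 measure0 lee_fin.
  by rewrite (_ : _ - _ - _ = 0) ?mulr0//; ring.
pose x1 : R := x0 + K%:R * s.
have Ks0 : 0 <= K%:R * s by rewrite mulr_ge0// ltW.
have x1K1 : x0 + K.+1%:R * s = x1 + s by rewrite /x1 -natr1; ring.
have x1K2 : x0 + K.+2%:R * s = x1 + s + s by rewrite /x1 -!natr1; ring.
rewrite x1K1 -/x1 in IH; rewrite x1K1 x1K2.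
have Tpos x : x0 <= x -> 0 < T x.
  by move=> x0x; apply: (lt_le_trans T0); apply: ndT.
set E := doubling_set T x0 s in mD IH *.
have sub : E `&` `[x0, x1 + s[ `<=`
    (E `&` `[x0, x1[) `|` (E `&` `[x1, x1 + s[).
  move=> x/= [Ex]; rewrite !in_itv/= => /andP[x0x xx1].
  have [xx|xx] := ltP x x1; [left|right]; split=> //; exact/andP.
(* A point [x] of the cell in [E] gives [T (x1 + 2s) >= T (x + s) > 2 T x >= 2 T x1], which pays for
   the full length [s]; otherwise the measure is 0 and the increment is nonnegative. *)
have cell : (lebesgue_measure (E `&` `[x1, (x1 + s)%R[) <=
    (s / ln 2 * (ln (T (x1 + s + s)) - ln (T x1)))%:E)%E.
  have [[x [[x0x dx] /=]]|none] := pselect (E `&` `[x1, x1 + s[ !=set0).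
    rewrite in_itv/= => /andP[x1x xx1].
    apply: (@le_trans _ _ (lebesgue_measure (`[x1, (x1 + s)%R[ : set R))).
      apply: le_measure; rewrite ?inE//; first exact: measurableI.
    rewrite lebesgue_measure_itv/= lte_fin ltrDl s0 -EFinD lee_fin.
    have -> : x1 + s - x1 = s by ring.
    rewrite mulrAC ler_pdivlMr// ler_pM2l//.
    have T1 : 0 < T x1 by apply: Tpos; rewrite /x1 lerDl.
    rewrite lerBrDr -lnM ?posrE//.
    rewrite ler_ln ?posrE ?mulr_gt0//; last by apply: Tpos; rewrite /x1; lra.
    apply: (@le_trans _ _ (2 * T x)).
      by rewrite ler_pM2l//; apply: ndT => //; rewrite /x1 lerDl.
    apply: (le_trans (ltW dx)); apply: ndT; lra.
  have -> : E `&` `[x1, x1 + s[ = set0.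
    by rewrite -subset0 => x Ex; apply: none; exists x.
  rewrite measure0 lee_fin mulr_ge0//; first by rewrite divr_ge0// ltW.
  rewrite subr_ge0 ler_ln ?posrE; first by apply: ndT; rewrite /x1; lra.
    by apply: Tpos; rewrite /x1; lra.
  by apply: Tpos; rewrite /x1; lra.
have mI (i : interval R) : measurable (E `&` [set` i]) by exact: measurableI.
apply: (@le_trans _ _ (lebesgue_measure
    ((E `&` `[x0, x1[) `|` (E `&` `[x1, (x1 + s)%R[)))).
  by apply: le_measure => //; rewrite inE; [exact: mI|apply: measurableU; exact: mI].
apply: (le_trans (@measureU2 _ _ _ (@lebesgue_measure R) _ _ (mI _) (mI _))).
apply: (le_trans (leeD IH cell)).
by rewrite -EFinD lee_fin le_eqVlt; apply/orP; left; apply/eqP; ring.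
Qed.

Lemma doubling_set_density {R : realType} (T : R -> R) (x0 s eps : R) :
  continuous T -> 0 < T x0 -> 0 < s ->
  (forall x y, x0 <= x -> x <= y -> T x <= T y) ->
  (forall e : R, 0 < e -> \forall r \near +oo, ln (T r) <= e * r) ->
  0 < eps ->
  \forall r \near +oo,
    (lebesgue_measure (doubling_set T x0 s `&` `[1%R, r]) <= (eps * r)%:E)%E.
Proof.
move=> cT T0 s0 ndT slow eps0.
have ln20 : 0 < ln 2 :> R by rewrite ln_gt0// ltr1n.
(* With this [e] the two upper logarithms contribute [eps / 2 * r] plus a constant; [rbig] below
   lets the other [eps / 2 * r] absorb all constants. *)
pose e := eps * ln 2 / (4 * s).
have e0 : 0 < e by rewrite divr_gt0 ?mulr_gt0.
have [M [_ slowM]] := slow e e0.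
have mD := measurable_doubling_set T x0 s cT.
near=> r.
have rx0 : x0 <= r by near: r; apply: nbhs_pinfty_ge; exact: num_real.
have rM : M < r by near: r; apply: nbhs_pinfty_gt; exact: num_real.
have rbig : (eps * s - 2 * s / ln 2 * ln (T x0)) * (2 / eps) <= r.
  by near: r; apply: nbhs_pinfty_ge; exact: num_real.
(* The cells just cover [[x0, r]], overshooting by at most [s], so both upper logarithms are taken
   at points at most [r + 2 * s]. *)
set K := (Num.truncn ((r - x0) / s)).+1.
have q0 : 0 <= (r - x0) / s by apply: divr_ge0; lra.
have /andP[Kle Kgt] := truncn_itv q0.
have r_lt : r < x0 + K%:R * s by move: Kgt; rewrite -/K ltr_pdivrMr//; lra.
have r_ge : x0 + K%:R * s <= r + s.
  by move: Kle; rewrite ler_pdivlMr// /K -natr1; lra.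
have K1E : x0 + K.+1%:R * s = x0 + K%:R * s + s by rewrite -natr1; ring.
apply: (@le_trans _ _ (lebesgue_measure
    (doubling_set T x0 s `&` `[x0, (x0 + K%:R * s)%R[))).
  apply: le_measure; rewrite ?inE; try exact: measurableI.
  move=> x [[x0x dx]]/=; rewrite in_itv/= => /andP[_ xr]; split; first by split.
  by rewrite /= in_itv/= x0x (le_lt_trans xr).
apply: (le_trans (doubling_set_cells T x0 s K cT T0 s0 ndT)).
rewrite lee_fin K1E.
have l1 : ln (T (x0 + K%:R * s + s)) <= e * (r + 2 * s).
  apply: (@le_trans _ _ (e * (x0 + K%:R * s + s))); first by apply: slowM; lra.
  by rewrite ler_pM2l//; lra.
have l0 : ln (T (x0 + K%:R * s)) <= e * (r + 2 * s).
  apply: (@le_trans _ _ (e * (x0 + K%:R * s))); first by apply: slowM; lra.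
  by rewrite ler_pM2l//; lra.
have ls : ln (T x0) <= ln (T (x0 + s)).
  have T0s : T x0 <= T (x0 + s) by apply: ndT; lra.
  by rewrite ler_ln// posrE (lt_le_trans T0).
have sl0 : 0 < s / ln 2 by rewrite divr_gt0.
apply: (@le_trans _ _ (s / ln 2 * (2 * (e * (r + 2 * s)) - 2 * ln (T x0)))).
  by rewrite ler_pM2l//; lra.
have -> : s / ln 2 * (2 * (e * (r + 2 * s)) - 2 * ln (T x0)) =
    eps / 2 * r + (eps * s - 2 * s / ln 2 * ln (T x0)).
  by rewrite /e; field; rewrite !gt_eqF.
have : (eps * s - 2 * s / ln 2 * ln (T x0)) <= eps / 2 * r.
  rewrite -(@ler_pM2r _ (2 / eps)) ?divr_gt0//.
  have -> : eps / 2 * r * (2 / eps) = r by field; rewrite gt_eqF.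
  by [].
lra.
Unshelve. all: by end_near.
Qed.

Lemma upper_density_eq0 {R : realType} (E : set R) :
  measurable E ->
  (forall eps : R, 0 < eps -> \forall r \near +oo,
    (lebesgue_measure (E `&` `[1%R, r]) <= (eps * r)%:E)%E) ->
  upper_density E = 0%E.
Proof.
move=> mE small.
have intE r : (\int[@lebesgue_measure R]_(t in E `&` `[1%R, r]) 1)%E =
    lebesgue_measure (E `&` `[1%R, r]).
  have mEr : measurable (E `&` `[1%R, r]) by exact: measurableI.
  by have := integral_cst (@lebesgue_measure R) mEr 1%E; rewrite mul1e.
apply/eqP; rewrite eq_le /upper_density; apply/andP; split; last first.
  apply: limf_esup_ge0.
    exact: filter_not_empty.
  move=> r; rewrite intE; have [r0|r0] := leP 0 r.
    by rewrite mule_ge0// lee_fin invr_ge0.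
  (* For [r < 0] the window [[1, r]] is empty, so the negative factor [r^-1] meets measure 0. *)
  by rewrite set_itv_ge ?setI0 ?measure0 ?mule0// bnd_simp -ltNge; lra.
apply/lee_addgt0Pr => eps eps0; rewrite add0e limf_esupE.
have [M [_ smallM]] := small eps eps0.
apply: (@le_trans _ _ (ereal_sup ((fun r : R => (r^-1)%:E *
   \int[@lebesgue_measure R]_(t in E `&` `[1%R, r]) 1)%E @`
   [set r | Num.max M 0 < r]))).
  apply: ereal_inf_lbound; exists [set r | Num.max M 0 < r] => //.
  by exists (Num.max M 0); split=> //; exact: num_real.
apply: ge_ereal_sup => _ [r /= + <-]; rewrite gt_max => /andP[Mr r0].
rewrite intE; apply: (@le_trans _ _ ((r^-1)%:E * (eps * r)%:E)%E).
  by apply: lee_wpmul2l; [rewrite lee_fin invr_ge0 ltW|exact: smallM].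
by rewrite -EFinM lee_fin mulrCA mulVf ?mulr1// gt_eqF.
Qed.

(* Take E to agree with F n on [rho n, rho n.+1[, where rho n grows so fast
   that F n already occupies at most a fraction 1/(n+1) of [1, r] for every
   r >= rho n. *)
Lemma zero_density_diagonal {R : realType} (F : nat -> set R) :
  (forall n, measurable (F n)) ->
  (forall m n, (m <= n)%N -> F m `<=` F n) ->
  (forall n (eps : R), 0 < eps -> \forall r \near +oo,
    (lebesgue_measure (F n `&` `[1%R, r]) <= (eps * r)%:E)%E) ->
  exists E : set R, [/\ measurable E, upper_density E = 0%E &
    forall n, \forall r \near +oo, ~ E r -> ~ F n r].
Proof.
move=> mF ndF smallF.
have /choice[M smallM] n : exists M : R, forall r, M < r ->
    (lebesgue_measure (F n `&` `[1%R, r]) <= (n.+1%:R^-1 * r)%:E)%E.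
  have n0 : 0 < n.+1%:R^-1 :> R by rewrite invr_gt0 ltr0n.
  by have [M [_ ?]] := smallF n _ n0; exists M.
(* Partial sums make [rho] exceed each [M n], be nondecreasing and dominate [n], so its cells
   exhaust [[rho 0, +oo[]. *)
pose rho n : R := \sum_(i < n.+1) (`|M i| + 1).
have rhoS n : rho n.+1 = rho n + (`|M n.+1| + 1) by rewrite /rho big_ord_recr.
have rho_ge0 n : 0 <= rho n by apply: sumr_ge0 => i _; apply: addr_ge0.
have rhoM n : M n < rho n.
  have MM := ler_norm (M n).
  case: n MM => [|n] MM; first by rewrite /rho big_ord1; lra.
  by rewrite rhoS; have := rho_ge0 n; lra.
have rho_nd m n : (m <= n)%N -> rho m <= rho n.
  elim: n => [|n IH]; first by rewrite leqn0 => /eqP->.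
  rewrite leq_eqVlt => /predU1P[->//|/IH le_mn].
  by apply: (le_trans le_mn); rewrite rhoS lerDl addr_ge0.
have rho_ge n : n%:R <= rho n.
  elim: n => [//|n IH]; rewrite rhoS -natr1.
  by have := normr_ge0 (M n.+1); lra.
have locate n r : rho n <= r -> exists m, [/\ (n <= m)%N, rho m <= r & r < rho m.+1].
  move=> nr; have r0 : 0 <= r by apply: le_trans nr.
  have exN : exists N, r < rho N.
    exists (Num.truncn r).+1; apply: lt_le_trans (rho_ge _).
    by case/andP: (truncn_itv r0).
  case: (ex_minnP exN) => N rN minN.
  have nN : (n < N)%N.
    rewrite ltnNge; apply/negP => Nn.
    by have := lt_le_trans rN (le_trans (rho_nd _ _ Nn) nr); rewrite ltxx.
  case: N rN minN nN => // m rN minN nm; exists m; split=> //.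
  rewrite leNgt; apply/negP => /minN; by rewrite ltnn.
pose E := \bigcup_n (F n `&` `[rho n, rho n.+1[).
have mE : measurable E.
  by apply: bigcup_measurable => n _; exact: measurableI.
exists E; split=> //.
  apply: upper_density_eq0 => // eps eps0.
  near (\oo : set_system nat) => n.
  have neps : n.+1%:R^-1 <= eps.
    apply/ltW; near: n; exact: near_infty_natSinv_lt (PosNum eps0).
  near=> r.
  have /locate[m [nm mr rm]] : rho n <= r by near: r; apply: nbhs_pinfty_ge; exact: num_real.
  have r0 : 0 <= r by apply: le_trans mr.
  apply: (@le_trans _ _ (lebesgue_measure (F m `&` `[1%R, r]))).
    apply: le_measure; rewrite ?inE; [exact: measurableI| |].
      by apply: measurableI => //; exact: mF.
    (* A point [x <= r] in cell [k] forces [k <= m], as [r < rho m.+1]; nestedness then puts [x] in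
       [F m]. *)
    move=> x [Ex xr1]; case: Ex => k _ [Fk].
    move: xr1; rewrite /= !in_itv/= => /andP[x1 xr] /andP[kx _].
    split; last by apply/andP.
    apply: (ndF k) => //; rewrite -ltnS ltnNge; apply/negP => mk.
    by have := lt_le_trans rm (le_trans (rho_nd _ _ mk) (le_trans kx xr)); rewrite ltxx.
  apply: (le_trans (smallM m r (lt_le_trans (rhoM m) mr))).
  rewrite lee_fin ler_wpM2r//; apply: le_trans neps.
  by rewrite lef_pV2 ?posrE ?ltr0n// ler_nat.
move=> n; near=> r => nEr Fnr; apply: nEr.
have /locate[m [nm mr rm]] : rho n <= r by near: r; apply: nbhs_pinfty_ge; exact: num_real.
by exists m => //; split; [exact: ndF Fnr|rewrite /= in_itv/= mr rm].
Unshelve. all: by end_near.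
Qed.

(** * The growth hypothesis and the final estimate *)

(** Otherwise [lne] is [-oo] at every positive [r], and so is the limit superior. *)
Lemma limf_esup_lne_gt0 {R : realType} (T : R -> R) :
  limf_esup (fun r : R => lne (T r)%:E * (r^-1)%:E)%E (pinfty_nbhs R) = 0%E ->
  exists2 r : R, 0 < r & 0 < T r.
Proof.
move=> limT; apply: contrapT => noT.
suff : (limf_esup (fun r : R => lne (T r)%:E * (r^-1)%:E)%E (pinfty_nbhs R)
        <= -oo)%E by rewrite limT.
rewrite limf_esupE; apply: (@le_trans _ _ (ereal_sup
  ((fun r : R => lne (T r)%:E * (r^-1)%:E)%E @` [set r | 0 < r]))).
  apply: ereal_inf_lbound; exists [set r | 0 < r] => //.
  by exists 0; split=> //; exact: num_real.
apply: ge_ereal_sup => _ [r /= r0 <-]; rewrite -[leLHS]/(lne (T r)%:E * (r^-1)%:E)%E.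
rewrite le0_lneNy; first by rewrite gt0_mulNye// lte_fin invr_gt0.
by rewrite lee_fin leNgt; apply/negP => Tr; apply: noT; exists r.
Qed.

Lemma limf_esup_lne_slow {R : realType} (T : R -> R) (e : R) :
  limf_esup (fun r : R => lne (T r)%:E * (r^-1)%:E)%E (pinfty_nbhs R) = 0%E ->
  0 < e -> \forall r \near +oo, ln (T r) <= e * r.
Proof.
move=> limT e0.
have : (limf_esup (fun r : R => lne (T r)%:E * (r^-1)%:E)%E (pinfty_nbhs R)
        < e%:E)%E by rewrite limT lte_fin.
rewrite limf_esupE => /ereal_inf_lt[_ [V nV <-] supV].
near=> r.
have r0 : 0 < r by near: r; apply: nbhs_pinfty_gt; exact: num_real.
have Vr : V r by near: r.
(* The real logarithm [ln] is 0 at nonpositive arguments, unlike [lne]. *)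
have [Tr|Tr] := leP (T r) 0; first by rewrite ln0// mulr_ge0// ltW.
have : (lne (T r)%:E * (r^-1)%:E <= e%:E)%E.
  by apply: (le_trans _ (ltW supV)); apply: ereal_sup_ubound; exists r.
by rewrite lne_EFin// -EFinM lee_fin ler_pdivrMr.
Unshelve. all: by end_near.
Qed.

Lemma continuous_cartan_char {R : realType} (f0 f1 : R -> R) :
  continuous f0 -> continuous f1 -> continuous (cartan_char f0 f1).
Proof.
move=> c0 c1.
have cF : continuous (fun x => trop_add (f0 x) (f1 x)).
  by move=> x; apply: continuous_max; [exact: c0|exact: c1].
move=> r; rewrite /cartan_char; apply: cvgB; last exact: cvg_cst.
apply: cvgM; first exact: cvg_cst.
apply: cvgD; first exact: cF.
apply: (@continuous_comp _ _ _ (fun r : R => - r)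
  (fun x => trop_add (f0 x) (f1 x))); last exact: cF.
by apply: cvgN; exact: cvg_id.
Qed.

Lemma proximity_ge0 {R : realType} (f : R -> R) (r : R) : 0 <= proximity f r.
Proof.
by rewrite mulr_ge0 ?invr_ge0// addr_ge0// /pos_part le_max lexx orbT.
Qed.

(* lne is the logarithm with values in \bar R and lne 0 = -oo *)
Theorem theorem3p1 (R : realType) (c : R) (f : R -> R) :
  c != 0 ->
  tropical_meromorphic f ->
  limf_esup (fun r : R => lne (characteristic f r)%:E * (r^-1)%:E)%E
    (pinfty_nbhs R) = 0%E ->
  exists E : set R,
    [/\ measurable E,
        upper_density E = 0%E &
        forall eps : R, 0 < eps ->
          \forall r \near pinfty_nbhs R, ~ E r ->
            `|proximity (fun x : R => trop_div (f (x + c)) (f x)) r|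
              <= eps * `|characteristic f r|].
Proof.
move=> _ _ growth.
have [x0 x0_gt0 Tx0] := limf_esup_lne_gt0 (characteristic f) growth.
(* The default value 0 of xget would make the limit superior -oo. *)
have [f0 [f1 [[ef0 ef1 _ fE] TE]]] : exists f0 f1 : R -> R,
    reduced_fraction f f0 f1 /\ characteristic f = cartan_char f0 f1.
  move: Tx0; rewrite /characteristic; case: xgetP => [T _ PT _|_]; first exact: PT.
  by rewrite ltxx.
have slow e := limf_esup_lne_slow (characteristic f) e growth.
rewrite TE in growth Tx0 slow *.
set T := cartan_char f0 f1 in growth Tx0 slow *.
have cf0 := tropical_entire_chord_convex f0 ef0.
have cf1 := tropical_entire_chord_convex f1 ef1.
have cF := chord_convex_max f0 f1 cf0 cf1.
have cT : continuous T.
  by apply: continuous_cartan_char; [case: ef0 => -[]|case: ef1 => -[]].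
have convT : chord_convex T by exact: chord_convex_jensen_mean.
have T0 : T 0 = 0 by exact: jensen_mean0.
have T_ge0 r : 0 <= r -> 0 <= T r by exact: jensen_mean_ge0.
have ndT x y : x0 <= x -> x <= y -> T x <= T y.
  move=> x0x xy; apply: star_shaped_nondecreasing => //; last lra.
  by apply: T_ge0; lra.
(* The shift includes [|c|] so that [r + s n] is the argument in [proximity_shift_bound] for length
   [n.+1]. *)
pose s (n : nat) : R := n.+1%:R + `|c|.
have s_gt0 n : 0 < s n by rewrite ltr_wpDr// ltr0n.
have nested m n : (m <= n)%N -> doubling_set T x0 (s m) `<=` doubling_set T x0 (s n).
  move=> mn r [x0r dr]; split=> //; apply: (lt_le_trans dr); apply: ndT.
    by have := s_gt0 m; lra.
  by rewrite lerD2l lerD2r ler_nat.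
have [E [mE densE nE]] := zero_density_diagonal (fun n => doubling_set T x0 (s n))
  (fun n => measurable_doubling_set T x0 (s n) cT) nested
  (fun n eps => doubling_set_density T x0 (s n) eps cT Tx0 (s_gt0 n) ndT slow).
exists E; split=> // eps eps0.
have [K bound] := proximity_shift_bound f f0 f1 c cf0 cf1 fE.
(* This gives [q <= eps / 4], so doubling yields [q * T (r + s n) <= eps / 2 * T r], leaving
   [eps / 2 * T r] for [K]. *)
pose n := Num.truncn (16 * `|c| / eps).
pose q := 4 * `|c| / n.+1%:R.
have q_ge0 : 0 <= q by rewrite divr_ge0// mulr_ge0.
have q_le : q <= eps / 4.
  have /truncn_itv/andP[_] : 0 <= 16 * `|c| / eps.
    by apply: divr_ge0; [apply: mulr_ge0|exact: ltW].
  by rewrite -/n ltr_pdivrMr// ler_pdivrMr ?ltr0n//; lra.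
have nEn := nE n.
near=> r => Er.
have rx0 : x0 <= r by near: r; apply: nbhs_pinfty_ge; exact: num_real.
have rc : 1 + `|c| <= r by near: r; apply: nbhs_pinfty_ge; exact: num_real.
(* The bound [T r >= r * T x0 / x0] turns this threshold into [K <= eps / 2 * T r]. *)
have rK : K / (eps / 2) * (x0 / T x0) <= r.
  by near: r; apply: nbhs_pinfty_ge; exact: num_real.
have Tr0 : 0 <= T r by apply: T_ge0; lra.
rewrite (ger0_norm (proximity_ge0 _ _)) (ger0_norm Tr0).
have double : T (r + s n) <= 2 * T r.
  rewrite leNgt; apply/negP => dr.
  suff : ~ doubling_set T x0 (s n) r by apply.
  by move: Er; near: r.
have KT : K <= eps / 2 * T r.
  have lin := star_shaped_le T x0 r convT T0 (ltW x0_gt0) rx0.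
  rewrite mulrC -ler_pdivrMr ?divr_gt0//.
  rewrite -(ler_pM2r x0_gt0) (mulrC (T r)); apply: le_trans lin.
  by rewrite -ler_pdivrMr// -mulrA.
apply: (le_trans (bound n.+1%:R r _ rc)); first by rewrite ler1n.
rewrite -/T -/q -addrA (addrC `|c|) -/(s n).
have qT := ler_wpM2l q_ge0 double.
have eT := ler_wpM2r Tr0 q_le.
lra.
Unshelve. all: by end_near.
Qed.
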